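(* Let $R$ be a ring, let $(\mathcal{L},\mathcal{A})$ be a complete duality pair over $R$ and let $\mathcal{P}$ be the class of projective left $R$-modules. The following conditions are equivalent for a left $R$-module $M$. (1) $M$ is strongly Gorenstein $(\mathcal{L},\mathcal{A})$-projective. (2) There exists a $\mathrm{Hom}_R(-,\mathcal{L})$-exact exact sequence $0\to M\to P\to M\to0$ with $P\in\mathcal{P}$. (3) There exists an exact sequence $0\to M\to P\to M\to0$ with $P\in\mathcal{P}$, and $\mathrm{Ext}^1_R(M,L)=0$ for all $L\in\mathcal{L}$. (4) There exists an exact sequence $0\to M\to P\to M\to0$ with $P\in\mathcal{P}$, and $\mathrm{Ext}^i_R(M,L)=0$ for all $L\in\mathcal{L}$ and $i\geq1$.
   Context: $R$ is an associative ring with identity; modules are left $R$-modules unless stated otherwise. For a module $M$, $M^+=\mathrm{Hom}_{\mathbb{Z}}(M,\mathbb{Q}/\mathbb{Z})$ is its character module (on the opposite side). Duality pairs: a duality pair over $R$ is a pair $(\mathcal{L},\mathcal{A})$, with $\mathcal{L}$ a class of left (resp. right) $R$-modules and $\mathcal{A}$ a class of right (resp. left) $R$-modules, such that $L\in\mathcal{L}$ if and only if $L^+\in\mathcal{A}$, and $\mathcal{A}$ is closed under direct summands and finite direct sums. With $\mathcal{L}$ a class of left modules, $(\mathcal{L},\mathcal{A})$ is perfect if $\mathcal{L}$ contains ${}_RR$ and is closed under coproducts and extensions. $(\mathcal{L},\mathcal{A})$ is complete if it is a perfect duality pair and $(\mathcal{A},\mathcal{L})$ is also a duality pair. Classes of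 modules are closed under isomorphism. Here $\mathcal{L}$ consists of left modules and $\mathcal{A}$ of right modules. A sequence is $\mathrm{Hom}_R(-,\mathcal{L})$-exact if it remains exact after applying $\mathrm{Hom}_R(-,L)$ for every $L\in\mathcal{L}$. A left $R$-module $M$ is strongly Gorenstein $(\mathcal{L},\mathcal{A})$-projective if there is a $\mathrm{Hom}_R(-,\mathcal{L})$-exact exact sequence $\cdots\xrightarrow{f}P\xrightarrow{f}P\xrightarrow{f}P\xrightarrow{f}\cdots$ (the same module and the same map in every degree) with $P$ projective such that $M\cong\mathrm{Ker} f$. *)

(* Defs.v *)
From HB Require Import structures.
From mathcomp Require Import all_boot all_order all_algebra.
From mathcomp Require Import all_classical.

Set Implicit Arguments.
Unset Strict Implicit.
Unset Printing Implicit Defensive.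

Import GRing.Theory.

Local Open Scope ring_scope.

(* A left R-module is an [lmodType R]; a right R-module is an [lmodType R^c], *)
(* i.e. a left module over the opposite ring.  [pzRingType] is the structure  *)
(* of associative rings with identity, the zero ring included.                *)

Definition onto (U V : Type) (f : U -> V) : Prop := forall v, exists u, f u = v.

Definition exact_at (U V W : zmodType) (f : U -> V) (g : V -> W) : Prop :=
  forall v, g v = 0 <-> exists u, f u = v.

Definition short_exact (U V W : zmodType) (f : U -> V) (g : V -> W) : Prop :=
  [/\ injective f, exact_at f g & onto g].

Definition isomorphic (R : pzRingType) (M N : lmodType R) : Prop :=
  exists f : {linear M -> N}, bijective f.

Definition projective (R : pzRingType) (P : lmodType R) : Prop :=
  forall (X Y : lmodType R) (g : {linear X -> Y}) (h : {linear P -> Y}),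
    onto g -> exists k : {linear P -> X}, forall x, g (k x) = h x.

(* The abelian group Hom_R(M, N), carried by [{linear M -> N}].               *)

Section Hom.
Variables (R : pzRingType) (M N : lmodType R).

Lemma hom_ext (f g : {linear M -> N}) : f =1 g -> f = g.
Proof.
case: f => f [[af] [sf]]; case: g => g [[ag] [sg]] /= fg.
have {fg} e : f = g by apply/funext.
by subst g; rewrite (Prop_irrelevance af ag) (Prop_irrelevance sf sg).
Qed.

HB.instance Definition _ := gen_eqMixin {linear M -> N}.
HB.instance Definition _ := gen_choiceMixin {linear M -> N}.

Definition hom_zero : {linear M -> N} := \0.
Definition hom_opp (f : {linear M -> N}) : {linear M -> N} := \- f.
Definition hom_add (f g : {linear M -> N}) : {linear M -> N} := f \+ g.

Fact hom_addA : associative hom_add.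
Proof. by move=> f g h; apply: hom_ext => x /=; rewrite addrA. Qed.
Fact hom_addC : commutative hom_add.
Proof. by move=> f g; apply: hom_ext => x /=; rewrite addrC. Qed.
Fact hom_add0 : left_id hom_zero hom_add.
Proof. by move=> f; apply: hom_ext => x /=; rewrite add0r. Qed.
Fact hom_addN : left_inverse hom_zero hom_opp hom_add.
Proof. by move=> f; apply: hom_ext => x /=; rewrite addNr. Qed.

HB.instance Definition _ := GRing.isZmodule.Build {linear M -> N}
  hom_addA hom_addC hom_add0 hom_addN.

End Hom.

(* [precomp f N] is Hom_R(f, N) : Hom_R(Y, N) -> Hom_R(X, N).                 *)

Section Precomp.
Variables (R : pzRingType) (X Y : lmodType R) (f : {linear X -> Y}).
Variable N : lmodType R.

Definition precomp (h : {linear Y -> N}) : {linear X -> N} := h \o f.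

Fact precomp_is_zmod_morphism : zmod_morphism precomp.
Proof. by move=> g h; apply: hom_ext. Qed.

HB.instance Definition _ :=
  GRing.isZmodMorphism.Build {linear Y -> N} {linear X -> N} precomp
    precomp_is_zmod_morphism.

End Precomp.

Arguments precomp {R X Y} f N h.

Definition ratZ : {pred rat} := fun q => q \is a Num.int.

Fact ratZ_zmod_closed : zmod_closed ratZ.
Proof. by split=> [|x y]; [exact: rpred0 | exact: rpredB]. Qed.

HB.instance Definition _ := GRing.isZmodClosed.Build rat ratZ ratZ_zmod_closed.

Definition QmodZ : zmodType := Quotient.quot ratZ.

(* Character modules M^+ = Hom_Z(M, Q/Z): for M left, (f r)(x) = f (r x), and *)
(* for M right, (r f)(x) = f (x r), where x r is written [r *: x] over R^c.   *)

Section AddHom.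
Variables M N : zmodType.

Lemma addhom_ext (f g : {additive M -> N}) : f =1 g -> f = g.
Proof.
case: f => f [[af]]; case: g => g [[ag]] /= fg.
have {fg} e : f = g by apply/funext.
by subst g; rewrite (Prop_irrelevance af ag).
Qed.

HB.instance Definition _ := gen_eqMixin {additive M -> N}.
HB.instance Definition _ := gen_choiceMixin {additive M -> N}.

Definition addhom_zero : {additive M -> N} := \0.
Definition addhom_opp (f : {additive M -> N}) : {additive M -> N} := \- f.
Definition addhom_add (f g : {additive M -> N}) : {additive M -> N} := f \+ g.

Fact addhom_addA : associative addhom_add.
Proof. by move=> f g h; apply: addhom_ext => x /=; rewrite addrA. Qed.
Fact addhom_addC : commutative addhom_add.
Proof. by move=> f g; apply: addhom_ext => x /=; rewrite addrC. Qed.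
Fact addhom_add0 : left_id addhom_zero addhom_add.
Proof. by move=> f; apply: addhom_ext => x /=; rewrite add0r. Qed.
Fact addhom_addN : left_inverse addhom_zero addhom_opp addhom_add.
Proof. by move=> f; apply: addhom_ext => x /=; rewrite addNr. Qed.

HB.instance Definition _ := GRing.isZmodule.Build {additive M -> N}
  addhom_addA addhom_addC addhom_add0 addhom_addN.

End AddHom.

Section CharacterOfLeft.
Variables (R : pzRingType) (M : lmodType R).

Definition lchar : Type := {additive M -> QmodZ}.
HB.instance Definition _ := GRing.Zmodule.on lchar.

Definition lchar_scale (r : R^c) (f : lchar) : lchar :=
  (f : {additive M -> QmodZ}) \o ( *:%R (r : R)).

Fact lchar_scaleA a b f : lchar_scale a (lchar_scale b f) = lchar_scale (a * b) f.
Proof. by apply: addhom_ext => x /=; rewrite scalerA. Qed.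
Fact lchar_scale1 : left_id 1 lchar_scale.
Proof. by move=> f; apply: addhom_ext => x /=; rewrite scale1r. Qed.
Fact lchar_scaleDr : right_distributive lchar_scale +%R.
Proof. by move=> a f g; apply: addhom_ext. Qed.
Fact lchar_scaleDl f : {morph lchar_scale^~ f : a b / a + b}.
Proof. by move=> a b; apply: addhom_ext => x /=; rewrite scalerDl raddfD. Qed.

HB.instance Definition _ := GRing.Zmodule_isLmodule.Build R^c lchar
  lchar_scaleA lchar_scale1 lchar_scaleDr lchar_scaleDl.

End CharacterOfLeft.

Section CharacterOfRight.
Variables (R : pzRingType) (M : lmodType R^c).

Definition rchar : Type := {additive M -> QmodZ}.
HB.instance Definition _ := GRing.Zmodule.on rchar.

Definition rchar_scale (r : R) (f : rchar) : rchar :=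
  (f : {additive M -> QmodZ}) \o ( *:%R (r : R^c)).

Fact rchar_scaleA a b f : rchar_scale a (rchar_scale b f) = rchar_scale (a * b) f.
Proof. by apply: addhom_ext => x /=; rewrite scalerA. Qed.
Fact rchar_scale1 : left_id 1 rchar_scale.
Proof. by move=> f; apply: addhom_ext => x /=; rewrite (scale1r x). Qed.
Fact rchar_scaleDr : right_distributive rchar_scale +%R.
Proof. by move=> a f g; apply: addhom_ext. Qed.
Fact rchar_scaleDl f : {morph rchar_scale^~ f : a b / a + b}.
Proof. by move=> a b; apply: addhom_ext => x /=; rewrite (scalerDl x) raddfD. Qed.

HB.instance Definition _ := GRing.Zmodule_isLmodule.Build R rchar
  rchar_scaleA rchar_scale1 rchar_scaleDr rchar_scaleDl.

End CharacterOfRight.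

Record module_class (R : pzRingType) := ModuleClass {
  in_class :> lmodType R -> Prop;
  in_class_iso : forall M N, isomorphic M N -> in_class M -> in_class N
}.

(* C, with the maps [inj i], is a coproduct (direct sum) of the family F.     *)
Definition is_coproduct (R : pzRingType) (I : Type) (F : I -> lmodType R)
    (C : lmodType R) (inj : forall i, {linear F i -> C}) : Prop :=
  forall (N : lmodType R) (g : forall i, {linear F i -> N}),
    exists! h : {linear C -> N}, forall i x, h (inj i x) = g i x.

Section Closure.
Variables (R : pzRingType) (K : module_class R).

Definition closed_coproducts : Prop :=
  forall (I : Type) (F : I -> lmodType R) (C : lmodType R)
         (inj : forall i, {linear F i -> C}),
    is_coproduct inj -> (forall i, K (F i)) -> K C.

Definition closed_finite_sums : Prop :=
  forall (n : nat) (F : 'I_n -> lmodType R) (C : lmodType R)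
         (inj : forall i, {linear F i -> C}),
    is_coproduct inj -> (forall i, K (F i)) -> K C.

Definition closed_summands : Prop :=
  forall X Y : lmodType R, K (X * Y)%type -> K X.

Definition closed_extensions : Prop :=
  forall (X Y Z : lmodType R) (f : {linear X -> Y}) (g : {linear Y -> Z}),
    short_exact f g -> K X -> K Z -> K Y.

End Closure.

(* [ch] is the character module functor: [@lchar R] or [@rchar R].            *)
Definition duality_pair (S T : pzRingType) (ch : lmodType S -> lmodType T)
    (K : module_class S) (B : module_class T) : Prop :=
  [/\ forall X, K X <-> B (ch X), closed_summands B & closed_finite_sums B].

Section DualityPairs.
Variables (R : pzRingType) (L : module_class R) (A : module_class R^c).

Definition perfect_duality_pair : Prop :=
  [/\ duality_pair (@lchar R) L A, L R^o, closed_coproducts L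
    & closed_extensions L].

Definition complete_duality_pair : Prop :=
  perfect_duality_pair /\ duality_pair (@rchar R) A L.

End DualityPairs.

Section Kernels.
Variables (R : pzRingType) (X Y : lmodType R) (f : {linear X -> Y}).

Definition ker_pred : {pred X} := fun x => f x == 0.

Fact ker_submod_closed : submod_closed ker_pred.
Proof.
split=> [|a x y]; rewrite !unfold_in ?raddf0 // => /eqP fx /eqP fy.
by rewrite linearP fx fy scaler0 addr0.
Qed.
HB.instance Definition _ := GRing.isSubmodClosed.Build R X ker_pred
  ker_submod_closed.

Record kernel := Kernel { ker_val : X; _ : ker_val \in ker_pred }.
HB.instance Definition _ := [isSub for ker_val].
HB.instance Definition _ := [Choice of kernel by <:].
HB.instance Definition _ := [SubChoice_isSubLmodule of kernel by <:].

End Kernels.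

Section Zsequences.
Variables (R : pzRingType) (X : int -> lmodType R).
Variable d : forall n, {linear X n -> X (n + 1)}.

Definition zseq_exact : Prop := forall n, exact_at (d n) (d (n + 1)).

Definition zseq_hom_exact (K : module_class R) : Prop :=
  forall N : lmodType R, K N ->
  forall n, exact_at (precomp (d (n + 1)) N) (precomp (d n) N).

End Zsequences.

(* 0 -> X -> Y -> Z -> 0 remains exact under Hom_R(-, N) for all N in K.      *)
Definition short_hom_exact (R : pzRingType) (K : module_class R)
    (X Y Z : lmodType R) (f : {linear X -> Y}) (g : {linear Y -> Z}) : Prop :=
  forall N : lmodType R, K N -> short_exact (precomp g N) (precomp f N).

(* Strongly Gorenstein (L, A)-projective modules: the second class A of the   *)
(* duality pair plays no role in the notion.                                  *)
Definition strongly_Gorenstein_projective (R : pzRingType) (L : module_class R)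
    (M : lmodType R) : Prop :=
  exists (P : lmodType R) (f : {linear P -> P}),
    let d := fun _ : int => f in
    [/\ projective P, zseq_exact (X := fun=> P) d,
        zseq_hom_exact (X := fun=> P) d L & isomorphic M (kernel f)].

Section Free.
Variables (R : pzRingType) (T : choiceType).

Definition finsupp_pred : {pred T -> R^o} :=
  fun f => `[< finite_set [set t | f t != 0]%classic >].

Fact finsupp_submod_closed : submod_closed finsupp_pred.
Proof.
split=> [|a f g]; rewrite !unfold_in.
  apply/asboolP; rewrite (_ : [set _ | _]%classic = set0) //.
  by rewrite -subset0 => t /=; rewrite eqxx.
move=> /asboolP ff /asboolP fg; apply/asboolP.
apply: (@sub_finite_set _ _ ([set t | f t != 0] `|` [set t | g t != 0])%classic).
  move=> t /=; case: (eqVneq (f t) 0) => ft; last by left.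
  case: (eqVneq (g t) 0) => gt; last by right.
  rewrite (_ : (_ + _) t = a *: f t + g t) // ft gt scaler0 addr0.
  by rewrite eqxx.
by rewrite finite_setU.
Qed.
HB.instance Definition _ := GRing.isSubmodClosed.Build R (T -> R^o) finsupp_pred
  finsupp_submod_closed.

Record free_module :=
  FreeModule { free_val : T -> R^o; _ : free_val \in finsupp_pred }.
HB.instance Definition _ := [isSub for free_val].
HB.instance Definition _ := [Choice of free_module by <:].
HB.instance Definition _ := [SubChoice_isSubLmodule of free_module by <:].

Variables (N : lmodType R) (u : T -> N).

Definition free_lift (f : free_module) : N :=
  \sum_(t \in [set: T]) (val f t : R) *: u t.

Fact free_lift_linear : linear free_lift.
Proof.
move=> a f g; rewrite /free_lift.
have [s0 s0E] : exists s : seq T,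
    ([set t | val f t != 0] `|` [set t | val g t != 0] = [set` s])%classic.
  apply/finite_seqP; rewrite finite_setU.
  by split; [exact/asboolP/(valP f) | exact/asboolP/(valP g)].
have vE t : val (a *: f + g) t = a * val f t + val g t by [].
pose s := undup s0.
have E (h : free_module) : (forall t, t \notin s -> val h t = 0) ->
    \sum_(t \in [set: T]) (val h t : R) *: u t
      = \sum_(t <- s) (val h t : R) *: u t.
  move=> h0; rewrite (fsbigE s) ?undup_uniq //.
    by apply: eq_bigl => t; rewrite in_setT.
  by move=> t _ ts; rewrite h0 // scale0r.
have sP t : t \notin s -> val f t = 0 /\ val g t = 0.
  rewrite mem_undup => /negP ts.
  have s0t : (([set t | val f t != 0] `|` [set t | val g t != 0]) `<=`
      [set` s0])%classic by rewrite s0E.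
  by split; apply/eqP/negPn/negP => nz; apply: ts; apply: s0t; [left|right].
rewrite (E f) => [|t /sP[]//]; rewrite (E g) => [|t /sP[]//].
rewrite (E (a *: f + g)); first last.
  by move=> t /sP[f0 g0]; rewrite vE f0 g0 mulr0 addr0.
rewrite scaler_sumr -big_split; apply: eq_bigr => t _.
by rewrite vE scalerDl scalerA.
Qed.

HB.instance Definition _ :=
  GRing.isLinear.Build R free_module N *:%R free_lift free_lift_linear.

End Free.

(* The standard free resolution ... -> F_1 -> F_0 -> M -> 0, where F_n is the *)
(* free module on the set of elements of the n-th syzygy.                     *)

Section Resolution.
Variables (R : pzRingType) (M : lmodType R).

Definition free_cover (N : lmodType R) : {linear free_module R N -> N} :=
  free_lift (@id N).

Fixpoint syzygy (n : nat) : lmodType R :=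
  if n is n'.+1 then kernel (free_cover (syzygy n')) else M.

Definition res (n : nat) : lmodType R := free_module R (syzygy n).

Definition res_d (n : nat) : {linear res n.+1 -> res n} :=
  (val : kernel (free_cover (syzygy n)) -> res n) \o free_cover (syzygy n.+1).

End Resolution.

(* Ker g / Im f; used with g \o f = 0, though the definition does not need it.*)

Section Homology.
Variables (U V W : zmodType) (f : {additive U -> V}) (g : {additive V -> W}).

Definition cocycle_pred : {pred V} := fun v => g v == 0.

Fact cocycle_zmod_closed : zmod_closed cocycle_pred.
Proof.
split=> [|x y]; rewrite !unfold_in ?raddf0 // => /eqP gx /eqP gy.
by rewrite raddfB gx gy subr0.
Qed.
HB.instance Definition _ :=
  GRing.isZmodClosed.Build V cocycle_pred cocycle_zmod_closed.

Record cocycle := Cocycle { cocycle_val : V; _ : cocycle_val \in cocycle_pred }.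
HB.instance Definition _ := [isSub for cocycle_val].
HB.instance Definition _ := [Choice of cocycle by <:].
HB.instance Definition _ := [SubChoice_isSubZmodule of cocycle by <:].

Definition coboundary : {pred cocycle} := fun z => `[< exists u, f u = val z >].

Fact coboundary_zmod_closed : zmod_closed coboundary.
Proof.
split=> [|x y]; rewrite !unfold_in.
  by apply/asboolP; exists 0; rewrite !raddf0.
move=> /asboolP[u fu] /asboolP[v fv]; apply/asboolP.
by exists (u - v); rewrite !raddfB fu fv.
Qed.
HB.instance Definition _ :=
  GRing.isZmodClosed.Build cocycle coboundary coboundary_zmod_closed.

Definition homology : zmodType := Quotient.quot coboundary.

End Homology.

(* Ext^n_R(M, N) = H^n(Hom_R(F_*, N)), F_* the standard free resolution of M. *)
Definition Ext (R : pzRingType) (n : nat) (M N : lmodType R) : zmodType :=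
  if n is n'.+1
  then homology (precomp (res_d M n') N) (precomp (res_d M n'.+1) N)
  else homology (\0 : {additive {linear res M 0 -> N} -> {linear res M 0 -> N}})
         (precomp (res_d M 0) N).

Definition Ext_vanishes (R : pzRingType) (n : nat) (M N : lmodType R) : Prop :=
  forall x : Ext n M N, x = 0.

(* Main.v *)
(* For 0 -> K -> P -> X -> 0 with P projective, Ext^1(X, N) = 0 says that     *)
(* every map K -> N extends to P, so for 0 -> M -> P -> M -> 0 this is        *)
(* Hom(-, N)-exactness.  Splicing copies of that sequence gives the periodic  *)
(* complex, and Hom(-, N)-exactness of the two is equivalent.  For the higher *)
(* Ext, a form of Schanuel's lemma shows by induction that all syzygies of M  *)
(* in the standard resolution are retracts of M plus a projective, and        *)
(* vanishing of Ext^1(-, N) passes to such retracts.                          *)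
From HB Require Import structures.
Require Import Defs.
From mathcomp Require Import all_boot all_order all_algebra all_classical.

Set Implicit Arguments.
Unset Strict Implicit.
Unset Printing Implicit Defensive.

Import GRing.Theory.

Local Open Scope ring_scope.

(** * Factoring linear maps, and comparing kernels of maps from projectives *)

Section Linear.
Variable R : pzRingType.
Implicit Types K P Q X Y N : lmodType R.

(** All four conditions reduce to one: there is 0 -> M -> P -> M -> 0 with P projective, along whose
    first map f every map M -> N with N in L extends to P. As Hom is left exact, this is (2). The
    differential of (1) factors as d = f g, with f the inclusion of its kernel, and conversely f g
    is such a differential. Since M is both quotient and kernel of P, it is its own syzygy;
    comparison with the standard resolution ([stable_retract_syzygy]) then makes extendability along
    f equivalent to Ext^1(M, N) = 0 and carries it to every higher Ext. *)

Definition linear_of X N (f : X -> N) (lf : linear f) : {linear X -> N} :=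
  HB.pack f (GRing.isLinear.Build R X N *:%R f lf).

Lemma factor_mono K P X (f : {linear K -> P}) (h : {linear X -> P}) :
  injective f -> (forall x, exists y, f y = h x) ->
  exists k : {linear X -> K}, forall x, f (k x) = h x.
Proof.
move=> fI /choice[k fk].
have lk : linear k by move=> a x y; apply: fI; rewrite linearP !fk linearP.
by exists (linear_of lk).
Qed.

(** A set-theoretic section [s] of [g] suffices: [h \o s] is linear because [h] kills the kernel of
    [g]. *)
Lemma factor_epi P X N (g : {linear P -> X}) (h : {linear P -> N}) :
  onto g -> (forall x, g x = 0 -> h x = 0) ->
  exists k : {linear X -> N}, forall x, k (g x) = h x.
Proof.
move=> /choice[s gs] gh.
have sg x : h (s (g x)) = h x.
  apply/eqP; rewrite -subr_eq0 -(linearB h); apply/eqP/gh.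
  by rewrite (linearB g) gs subrr.
have lk : linear (h \o s).
  move=> a x y /=; rewrite -{1}(gs x) -{1}(gs y) -linearP sg; exact: linearP.
by exists (linear_of lk) => x /=.
Qed.

Lemma hom_eq1 X N (h k : {linear X -> N}) : h = k -> h =1 k.
Proof. by move->. Qed.

Definition extendable K P (f : {linear K -> P}) N :=
  forall h : {linear K -> N},
  exists k : {linear P -> N}, forall x, k (f x) = h x.

Lemma extendableP K P (f : {linear K -> P}) N :
  extendable f N <-> onto (precomp f N).
Proof.
split=> H h; have [k kh] := H h; exists k; first exact: hom_ext.
by move=> x; rewrite -kh.
Qed.

(** Hom(-, N) is left exact, so only surjectivity of restriction along [f] is at stake. *)
Lemma short_exact_precomp K P X (f : {linear K -> P}) (g : {linear P -> X}) N :
  short_exact f g -> extendable f N -> short_exact (precomp g N) (precomp f N).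
Proof.
move=> [fI fg gS] /extendableP fN; split=> // [h h' hh'|h].
  by apply: hom_ext => x; have [p <-] := gS x; exact: (hom_eq1 hh' p).
split=> [hf|[k <-]].
  have [|k kh] := @factor_epi _ _ _ g h gS.
    by move=> x /fg[y <-]; exact: (hom_eq1 hf y).
  by exists k; exact: hom_ext.
apply: hom_ext => x /=.
by rewrite (_ : g (f x) = 0) ?raddf0 //; apply/fg; exists x.
Qed.

(* [X] is a retract of [Y + Q] for some projective [Q]. *)
Definition stable_retract X Y :=
  exists (Q : lmodType R) (a : {linear X -> Y}) (b : {linear Y -> X})
    (u : {linear X -> Q}) (v : {linear Q -> X}),
    projective Q /\ forall x, b (a x) + v (u x) = x.

Lemma stable_retract_refl X Q : projective Q -> stable_retract X X.
Proof.
move=> projQ; pose z (Y Z : lmodType R) : {linear Y -> Z} := \0.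
by exists Q, idfun, idfun, (z X Q), (z Q X); split=> // x; rewrite addr0.
Qed.

(* Lift the retraction to [P] and [P']: composing the lifts differs from the  *)
(* identity of [P] by a map into the kernel [K], which is [s].                *)
Lemma compare_kernels K P X K' P' X' (f : {linear K -> P}) (g : {linear P -> X})
    (f' : {linear K' -> P'}) (g' : {linear P' -> X'}) :
  short_exact f g -> short_exact f' g' -> projective P -> projective P' ->
  stable_retract X X' ->
  exists (a : {linear P -> P'}) (a' : {linear K -> K'}) (b' : {linear K' -> K})
      (s : {linear P -> K}),
    (forall x, f' (a' x) = a (f x)) /\ (forall x, b' (a' x) + s (f x) = x).
Proof.
move=> [fI fg gS] [fI' fg' gS'] pP pP' [Q [a0 [b0 [u [v [pQ abuv]]]]]].
have [a ga] := pP _ _ g' (a0 \o g) gS'.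
have [b gb] := pP' _ _ g (b0 \o g') gS.
have [w gw] := pQ _ _ g v gS.
have gf x : g (f x) = 0 by apply/fg; exists x.
have gf' x : g' (f' x) = 0 by apply/fg'; exists x.
have [|a' fa'] := @factor_mono _ _ _ f' (a \o f) fI'.
  by move=> x; apply/fg'; rewrite /= ga /= gf raddf0.
have [|b' fb'] := @factor_mono _ _ _ f (b \o f') fI.
  by move=> x; apply/fg; rewrite /= gb /= gf' raddf0.
have [|s fs] := @factor_mono _ _ _ f (idfun \- ((b \o a) \+ (w \o u \o g))) fI.
  move=> x; apply/fg; rewrite /= (linearB g) (linearD g) gb gw /= ga /=.
  by rewrite abuv subrr.
exists a, a', b', s; split=> // x; apply: fI.
by rewrite (linearD f) fb' fs /= fa' /= gf !raddf0 addr0 addrC subrK.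
Qed.

(** The projective summand is [P], entered by [f] and left by [s]. *)
Lemma stable_retract_kernel K P X K' P' X' (f : {linear K -> P})
    (g : {linear P -> X}) (f' : {linear K' -> P'}) (g' : {linear P' -> X'}) :
  short_exact f g -> short_exact f' g' -> projective P -> projective P' ->
  stable_retract X X' -> stable_retract K K'.
Proof.
move=> fg fg' pP pP' XX'.
have [a [a' [b' [s [_ E]]]]] := compare_kernels fg fg' pP pP' XX'.
by exists P, a', b', f, s.
Qed.

Lemma stable_retract_extendable K P X K' P' X' (f : {linear K -> P})
    (g : {linear P -> X}) (f' : {linear K' -> P'}) (g' : {linear P' -> X'}) N :
  short_exact f g -> short_exact f' g' -> projective P -> projective P' ->
  stable_retract X X' -> extendable f' N -> extendable f N.
Proof.
move=> fg fg' pP pP' XX' eN h.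
have [a [a' [b' [s [aE E]]]]] := compare_kernels fg fg' pP pP' XX'.
have [k kE] := eN (h \o b').
(* On K, [k \o a] restricts to [h \o b' \o a']; the term [h \o s] makes up the difference to [h]. *)
exists ((k \o a) \+ (h \o s)) => x /=.
by rewrite -aE kE /= -(linearD h) E.
Qed.

End Linear.

Lemma homology_vanishes (U V W : zmodType) (f : {additive U -> V})
    (g : {additive V -> W}) :
  (forall x : homology f g, x = 0) <->
  (forall v, g v = 0 -> exists u, f u = v).
Proof.
have piE (z : cocycle g) :
    (\pi_(homology f g) z = 0)%qT <-> exists u, f u = val z.
  have -> : 0 = (\pi_(homology f g) 0)%qT by rewrite piE.
  split=> [/eqP|/asboolP fz].
    by rewrite -Quotient.idealrBE subr0 => /asboolP.
  by apply/eqP; rewrite -Quotient.idealrBE subr0.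
split=> [H v /eqP gv | H x].
  by have /piE := H (\pi_(homology f g) (Cocycle (gv : v \in cocycle_pred g)))%qT.
rewrite -[x]reprK; apply/piE/H; exact/eqP/(valP (repr x)).
Qed.

(** * Free modules, and Ext as an extension problem for syzygies *)

Section Free.
Variable R : pzRingType.
Section Basis.
Variable T : choiceType.

Fact basis_subproof (t : T) :
  (fun s : T => (s == t)%:R : R^o) \in @finsupp_pred R T.
Proof.
apply/asboolP; apply: (@sub_finite_set _ _ [set t]%classic) => // s /=.
by case: (s =P t) => // _; rewrite eqxx.
Qed.

Definition basis (t : T) : free_module R T := FreeModule (basis_subproof t).

Lemma free_lift_basis (N : lmodType R) (u : T -> N) t :
  free_lift u (basis t) = u t.
Proof.
rewrite /free_lift (fsbigE [:: t]) //=; first last.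
  by move=> s _; rewrite inE => /negPf ->; rewrite scale0r.
by rewrite big_cons big_nil in_setT addr0 eqxx scale1r.
Qed.

Lemma free_linear_ext (N : lmodType R) (h k : {linear free_module R T -> N}) :
  (forall t, h (basis t) = k (basis t)) -> h =1 k.
Proof.
move=> hk f.
have [s0 s0E] : exists s : seq T, ([set t | val f t != 0] = [set` s])%classic.
  by apply/finite_seqP; exact/asboolP/(valP f).
pose s := undup s0.
(* Expand [f] in the basis over its finite support. *)
have -> : f = \sum_(t <- s) (val f t : R) *: basis t.
  apply: val_inj; apply/funext => x.
  have -> : val (\sum_(t <- s) (val f t : R) *: basis t) x =
      \sum_(t <- s) (val f t : R) * (x == t)%:R.
    elim: s => [|t r IHr]; first by rewrite !big_nil.
    by rewrite !big_cons -IHr.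
  have [xs|xs] := boolP (x \in s).
    rewrite (bigD1_seq x) ?undup_uniq //= eqxx mulr1 big1 ?addr0 // => t.
    by rewrite eq_sym => /negPf ->; rewrite mulr0.
  rewrite big1_seq => [|t /andP[_ ts]]; last first.
    by rewrite (_ : x == t = false) ?mulr0 //; apply: contraNF xs => /eqP ->.
  apply/eqP; apply: contraNT xs => fx; rewrite mem_undup.
  by have : [set` s0]%classic x by rewrite -s0E.
by rewrite !linear_sum; apply: eq_bigr => t _; rewrite !linearZ hk.
Qed.
End Basis.

Lemma projective_free (T : choiceType) : projective (free_module R T).
Proof.
move=> X Y g h /choice[s gs].
exists (free_lift (fun t => s (h (basis t)))).
apply: (@free_linear_ext T Y (g \o free_lift _) h) => t /=.
by rewrite free_lift_basis gs.
Qed.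

Lemma short_exact_free_cover (X : lmodType R) :
  short_exact (val : kernel (free_cover X) -> _) (free_cover X).
Proof.
split=> [|x|x]; first exact: val_inj.
  split=> [/eqP x0|[y <-]]; last exact/eqP/(valP y).
  by exists (Kernel (x0 : x \in ker_pred (free_cover X))).
by exists (basis x); exact: free_lift_basis.
Qed.

Definition syzygy_incl (M : lmodType R) n : {linear syzygy M n.+1 -> res M n} :=
  (val : kernel (free_cover (syzygy M n)) -> _).

(** Dimension shifting: cocycles on F_(n+1) are the maps factoring through the syzygy of index n+1,
    and such a map is a coboundary exactly when its factor extends to F_n. *)
Lemma Ext_vanishesP n (M N : lmodType R) :
  Ext_vanishes n.+1 M N <-> extendable (syzygy_incl M n) N.
Proof.
have [_ fg gS] := short_exact_free_cover (syzygy M n.+1).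
split.
  move=> /homology_vanishes H h.
  have [|k hk] := H (h \o free_cover (syzygy M n.+1)).
    apply: hom_ext => x /=.
    by rewrite (_ : free_cover _ _ = 0) ?raddf0 //; apply/fg; eexists.
  by exists k => x; have [y <-] := gS x; exact: (hom_eq1 hk y).
move=> H; apply/homology_vanishes => c c0.
have [|h hE] := @factor_epi _ _ _ _ (free_cover (syzygy M n.+1)) c gS.
  move=> x /fg[y <-].
  have [_ _ gS2] := short_exact_free_cover (syzygy M n.+2).
  by have [z <-] := gS2 y; exact: (hom_eq1 c0 z).
have [k kE] := H h; exists k.
by apply: hom_ext => x /=; rewrite kE hE.
Qed.
End Free.

(** * Modules that are their own syzygy *)

Section Periodic.
Variables (R : pzRingType) (M P : lmodType R).
Variables (f : {linear M -> P}) (g : {linear P -> M}).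
Hypotheses (projP : projective P) (fg : short_exact f g).

(** Passing to kernels advances the syzygy by one but returns M to itself. *)
Lemma stable_retract_syzygy n : stable_retract (syzygy M n) M.
Proof.
elim: n => [|n IHn]; first exact: stable_retract_refl projP.
apply: (stable_retract_kernel (short_exact_free_cover (syzygy M n)) fg) => //.
exact: projective_free.
Qed.

Lemma extendable_Ext_vanishes n N : extendable f N -> Ext_vanishes n.+1 M N.
Proof.
move=> fN; apply/Ext_vanishesP.
apply: (stable_retract_extendable _ fg _ projP _ fN).
- exact: short_exact_free_cover.
- exact: projective_free.
- exact: stable_retract_syzygy.
Qed.

Lemma Ext1_vanishes_extendable N : Ext_vanishes 1 M N -> extendable f N.
Proof.
move/Ext_vanishesP.
apply: (stable_retract_extendable fg (short_exact_free_cover M)) => //.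
  exact: projective_free.
exact: stable_retract_refl projP.
Qed.

Lemma strongly_Gorenstein_projective_extendable (L : module_class R) :
  (forall N, L N -> extendable f N) -> strongly_Gorenstein_projective L M.
Proof.
have [fI fgE gS] := fg => fL.
have gf x : g (f x) = 0 by apply/fgE; exists x.
exists P, (f \o g); split=> //.
- move=> _ p; split=> [fgp|[q <-]] /=; last by rewrite gf raddf0.
  have /fgE[m <-] : g p = 0 by apply: fI; rewrite raddf0.
  by have [q <-] := gS m; exists q.
- move=> N LN _ h; split=> [hfg|[k <-]]; last first.
    by apply: hom_ext => x /=; rewrite gf !raddf0.
  have [|h' hE] := @factor_epi _ _ _ _ g h gS.
    (* A kernel element of [g] has the form [f (g q)], which [h] kills, so [h] descends to M. *)
    move=> p /fgE[m <-]; have [q <-] := gS m.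
    exact: (hom_eq1 hfg q).
  have [k kE] := fL N LN h'; exists k.
  by apply: hom_ext => p /=; rewrite kE hE.
have [|k kE] := @factor_mono _ _ _ _ (val : kernel (f \o g) -> _) f val_inj.
  move=> m; have fm : f m \in ker_pred (f \o g).
    by apply/eqP; rewrite /= gf raddf0.
  by exists (Kernel fm).
have /choice[j kj] : onto k.
  move=> y; have /fgE[m fm] : g (val y) = 0.
    by apply: fI; rewrite raddf0; exact/eqP/(valP y).
  by exists m; apply: val_inj; rewrite kE.
have kI : injective k by move=> x y kxy; apply: fI; rewrite -!kE kxy.
by exists k; exists j => // x; exact: kI.
Qed.
End Periodic.

Lemma periodic_short_exact (R : pzRingType) (L : module_class R)
    (M : lmodType R) :
  strongly_Gorenstein_projective L M ->
  exists (P : lmodType R) (f : {linear M -> P}) (g : {linear P -> M}),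
      [/\ projective P, short_exact f g & forall N, L N -> extendable f N].
Proof.
move=> [P [d [projP /(_ 0) dd dL [i [j ij ji]]]]].
pose f : {linear M -> P} := (val : kernel d -> P) \o i.
have fI : injective f by apply: inj_comp; [exact: val_inj|exact: can_inj ij].
have fE p : d p = 0 <-> exists m, f m = p.
  split=> [/eqP dp|[m <-]]; last exact/eqP/(valP (i m)).
  by exists (j (Kernel (dp : p \in ker_pred d))); rewrite /f /= ji.
have [|g gE] := @factor_mono _ _ _ _ f d fI.
  by move=> p; apply/fE/dd; exists p.
have gS : onto g.
  move=> m; have /dd[p dp] : d (f m) = 0 by apply/fE; exists m.
  by exists p; apply: fI; rewrite gE.
exists P, f, g; split=> //.
  split=> // p; rewrite -fE -gE; split=> [->|]; first exact: raddf0.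
  by rewrite -[RHS](raddf0 f) => /fI.
move=> N LN h.
(* Hom-exactness gives [h \o g = k \o d = k \o f \o g]; cancelling the surjection [g] leaves
   [h = k \o f]. *)
have /(dL N LN 0)[k kE] : precomp d N (h \o g) = 0.
  apply: hom_ext => p /=; rewrite (_ : g (d p) = 0) ?raddf0 //.
  by apply: fI; rewrite gE raddf0; apply/dd; exists p.
exists k => m; have [p <-] := gS m.
by rewrite gE; exact: (hom_eq1 kE p).
Qed.

Theorem proposition4p2 (R : pzRingType) (L : module_class R)
    (A : module_class R^c) (LA : complete_duality_pair L A) (M : lmodType R) :
  [<->
    strongly_Gorenstein_projective L M;

    exists (P : lmodType R) (f : {linear M -> P}) (g : {linear P -> M}),
      [/\ projective P, short_exact f g & short_hom_exact L f g];

    (exists (P : lmodType R) (f : {linear M -> P}) (g : {linear P -> M}),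
      projective P /\ short_exact f g) /\
    (forall N : lmodType R, L N -> Ext_vanishes 1 M N);

    (exists (P : lmodType R) (f : {linear M -> P}) (g : {linear P -> M}),
      projective P /\ short_exact f g) /\
    (forall N : lmodType R, L N ->
      forall i : nat, (1 <= i)%N -> Ext_vanishes i M N)].
Proof.
tfae.
- move=> /periodic_short_exact[P [f [g [projP fg fL]]]].
  exists P, f, g; split=> // N LN; apply: short_exact_precomp => //; exact: fL.
- move=> [P [f [g [projP fg fL]]]]; split; first by exists P, f, g.
  move=> N LN; apply: (extendable_Ext_vanishes projP fg).
  by apply/extendableP; have [] := fL N LN.
- move=> [[P [f [g [projP fg]]]] ML]; split; first by exists P, f, g.
  move=> N LN [//|n] _; apply: (extendable_Ext_vanishes projP fg).
  exact/(Ext1_vanishes_extendable projP fg)/ML.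
- move=> [[P [f [g [projP fg]]]] ML].
  apply: (strongly_Gorenstein_projective_extendable projP fg) => N LN.
  (* The case i = 1 already gives extendability. *)
  exact/(Ext1_vanishes_extendable projP fg)/ML.
Qed.
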